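(* Let $p\ge 1$ be an integer and let $F$ be a polyharmonic ($p$-harmonic) mapping in the unit disk $\mathbb{D}$ of the form $$F(z)=a_{0}+\sum_{k=1}^{p}|z|^{2(k-1)}\big(h_{k}(z)+\overline{g_{k}(z)}\big)=a_{0}+\sum_{k=1}^{p}|z|^{2(k-1)}\sum_{n=1}^{\infty}\big(a_{n,k}z^{n}+\overline{b_{n,k}}\,\overline{z}^{n}\big),$$ where $h_k(z)=\sum_{n\ge1}a_{n,k}z^n$ and $g_k(z)=\sum_{n\ge 1}b_{n,k}z^n$ are analytic in $\mathbb{D}$. Suppose that for all $n\ge1$ and $k_1,k_2,k_3,k_4\in\{1,\dots,p\}$, all non-zero coefficients $a_{n,k_{1}},a_{n,k_{2}}$ and $b_{n,k_{3}},b_{n,k_{4}}$ satisfy $$\left|\arg \frac{a_{n,k_{1}}}{a_{n,k_{2}}}\right|\leq\frac{\pi}{2}\quad\text{and}\quad\left|\arg \frac{b_{n,k_{3}}}{b_{n,k_{4}}}\right|\leq\frac{\pi}{2}.$$ Let $M>0$. (I) If $|F(z)|\leq M$ for all $z\in \mathbb{D}$, then $$|a_{0}|^{2}+\sum_{k=1}^{p}\sum_{n=1}^{\infty}\big(|a_{n,k}|^{2}+|b_{n,k}|^{2}\big)\leq M^{2},$$ and $|a_{n,k}|+|b_{n,k}|\leq\sqrt{2}M$ for all $n\ge 1$, $1\le k\le p$. (II) If $|F(z)|\leq M$ for all $z\in \mathbb{D}$ and $F(0)=|J_{F}(0)|-1=0$, then $$\sqrt{\sum_{k=1}^{p}\sum_{n=1}^{\infty}(|a_{n,k}|+|b_{n,k}|)^{2}-(|a_{1,1}|+|b_{1,1}|)^{2}}\leq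 \sqrt{M^{4}-1}\cdot \lambda_{F}(0),$$ and $$|a_{n,k}|+|b_{n,k}|\leq T_{1}(M):=\min \left\{\sqrt{2M^{2}-2},\;\sqrt{M^{4}-1}\cdot \lambda_{F}(0)\right\}$$ for all $(n,k)\neq(1,1)$, where $$\lambda_{F}(0)\geq\lambda_{0}(M):=\frac{\sqrt{2}}{\sqrt{M^{2}-1}+\sqrt{M^{2}+1}}.$$ (III) If $|F(z)|\leq M$ for all $z\in \mathbb{D}$ and $F(0)=\lambda_{F}(0)-1=0$, then $$\sqrt{\sum_{k=1}^{p}\sum_{n=1}^{\infty}(|a_{n,k}|+|b_{n,k}|)^{2}-(|a_{1,1}|+|b_{1,1}|)^{2}}\leq \sqrt{2M^{2}-2},$$ and $|a_{n,k}|+|b_{n,k}|\leq \sqrt{2M^{2}-2}$ for all $(n,k)\neq(1,1)$.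
   Context: $\mathbb{D}=\{z\in\mathbb{C}:|z|<1\}$. A $2p$ times continuously differentiable complex-valued mapping $F$ in a domain is polyharmonic (or $p$-harmonic), $p\ge1$, if $\Delta^pF=0$, where $\Delta=4\,\partial^2/\partial z\partial\overline z$ is the Laplacian and $\Delta^pF=\Delta(\Delta^{p-1}F)$. The argument $\arg$ is the principal value in $(-\pi,\pi]$. The Jacobian is $J_F(z)=|F_z(z)|^2-|F_{\overline z}(z)|^2$, and $\lambda_F(z)=\big||F_z(z)|-|F_{\overline z}(z)|\big|$. *)

(* Defs.v *)
(* Stdlib reals with Coquelicot: C = R * R. *)
From Stdlib Require Import Reals Lra.
From Coquelicot Require Import Coquelicot.
Open Scope R_scope.

Definition unit_disk (z : C) : Prop := Cmod z < 1.

(* Partial derivatives of a complex-valued function of z = (x, y). Derive is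
   total: these are meaningful only where the partial derivatives exist (see
   ex_partials). *)
Definition Cdx (F : C -> C) (z : C) : C :=
  (Derive (fun t => Re (F (t, Im z))) (Re z),
   Derive (fun t => Im (F (t, Im z))) (Re z)).

Definition Cdy (F : C -> C) (z : C) : C :=
  (Derive (fun t => Re (F (Re z, t))) (Im z),
   Derive (fun t => Im (F (Re z, t))) (Im z)).

Definition ex_partials (F : C -> C) (z : C) : Prop :=
  ex_derive (fun t : R => Re (F (t, Im z))) (Re z) /\
  ex_derive (fun t : R => Im (F (t, Im z))) (Re z) /\
  ex_derive (fun t : R => Re (F (Re z, t))) (Im z) /\
  ex_derive (fun t : R => Im (F (Re z, t))) (Im z).

(* Wirtinger derivatives F_z and F_{\bar z}. *)
Definition dz (F : C -> C) (z : C) : C := ((Cdx F z - Ci * Cdy F z) / 2)%C.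

Definition dzbar (F : C -> C) (z : C) : C := ((Cdx F z + Ci * Cdy F z) / 2)%C.

Definition Laplacian (F : C -> C) (z : C) : C := (4 * dz (dzbar F) z)%C.

(* F is m times continuously differentiable (in the real sense) on the open
   set U. *)
Fixpoint continuously_differentiable (m : nat) (U : C -> Prop) (F : C -> C)
  : Prop :=
  match m with
  | O => forall z : C, U z -> continuous F z
  | S m' =>
      (forall z : C, U z -> continuous F z /\ ex_partials F z) /\
      continuously_differentiable m' U (Cdx F) /\
      continuously_differentiable m' U (Cdy F)
  end.

Definition polyharmonic (p : nat) (U : C -> Prop) (F : C -> C) : Prop :=
  continuously_differentiable (2 * p) U F /\
  forall z : C, U z -> Nat.iter p Laplacian F z = RtoC 0.

Definition holomorphic (U : C -> Prop) (f : C -> C) : Prop :=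
  forall z : C, U z -> @ex_derive C_AbsRing C_NormedModule f z.

Definition Jacobian (F : C -> C) (z : C) : R :=
  Cmod (dz F z) ^ 2 - Cmod (dzbar F z) ^ 2.

Definition lambda (F : C -> C) (z : C) : R :=
  Rabs (Cmod (dz F z) - Cmod (dzbar F z)).

(* Principal argument, with values in (-PI, PI]; see Carg_spec. The value at 0
   is irrelevant. *)
Definition Carg (z : C) : R :=
  if Rle_dec 0 (Im z) then acos (Re z / Cmod z) else - acos (Re z / Cmod z).

Lemma Carg_spec (z : C) : z <> RtoC 0 ->
  - PI < Carg z <= PI /\
  z = (Cmod z * (cos (Carg z), sin (Carg z)))%C.
Proof.
intros Hz.
assert (Hm : 0 < Cmod z) by (apply Cmod_gt_0; exact Hz).
assert (Hsq := Cmod2_alt z).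
destruct z as [x y]; simpl Re in *; simpl Im in *.
set (m := Cmod (x, y)) in *.
assert (Hc : Rsqr (x / m) = 1 - Rsqr (y / m)).
{ unfold Rsqr. replace (x / m * (x / m)) with (x ^ 2 / m ^ 2) by (field; lra).
  replace (x ^ 2) with (m ^ 2 - y ^ 2) by lra. field; lra. }
assert (Hb : -1 <= x / m <= 1).
{ assert (Rsqr (x / m) <= Rsqr 1)
    by (rewrite Hc, Rsqr_1; pose proof (Rle_0_sqr (y / m)); lra).
  apply Rsqr_le_abs_0 in H. rewrite Rabs_R1 in H.
  apply Rabs_le_between in H. exact H. }
assert (Hacos := acos_bound (x / m)).
assert (Hs : sin (acos (x / m)) = Rabs (y / m)).
{ rewrite sin_acos by exact Hb. rewrite Hc.
  replace (1 - (1 - Rsqr (y / m))) with (Rsqr (y / m)) by ring.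
  apply sqrt_Rsqr_abs. }
assert (Hco := cos_acos _ Hb).
assert (Hpi := PI_RGT_0).
unfold Carg; simpl Re; simpl Im; fold m.
destruct (Rle_dec 0 y) as [Hy | Hy].
- split; [lra |].
  rewrite Hs, Hco, Rabs_pos_eq
    by (apply Rmult_le_pos; [lra | left; apply Rinv_0_lt_compat; lra]).
  unfold Cmult, RtoC; simpl; f_equal; field; lra.
- assert (Hneg : y / m < 0).
  { replace (y / m) with (- (- y / m)) by (field; lra).
    assert (0 < - y / m) by (apply Rdiv_lt_0_compat; lra). lra. }
  rewrite Rabs_left in Hs by exact Hneg.
  split.
  + split; [| lra].
    destruct (Req_dec (acos (x / m)) PI) as [E | E]; [| lra].
    rewrite E, sin_PI in Hs. lra.
  + rewrite sin_neg, cos_neg, Hs, Hco.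
    unfold Cmult, RtoC; simpl; f_equal; field; lra.
Qed.

Definition T1 (M : R) (F : C -> C) : R :=
  Rmin (sqrt (2 * M ^ 2 - 2)) (sqrt (M ^ 4 - 1) * lambda F (RtoC 0)).

Definition lambda0 (M : R) : R :=
  sqrt 2 / (sqrt (M ^ 2 - 1) + sqrt (M ^ 2 + 1)).

(* Main.v *)
Require Import Defs.
From Stdlib Require Import Reals Lra Lia.
From Coquelicot Require Import Coquelicot.
Open Scope R_scope.

(** The heart of the matter is Parseval's inequality on the circles |z| = r.
    There F is an absolutely convergent trigonometric series: the coefficient of
    exp(i n t) is the sum over k of r^(2(k-1)+n) a_(n,k), and the coefficient of
    exp(-i n t) is the same expression in the conjugates of the b_(n,k).  Since
    |F| <= M, the squared moduli of these coefficients and of a_0 add up to at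
    most M^2 ([circle_parseval_le]).

    The condition on arguments says that, for fixed n, the numbers a_(n,k) have
    pairwise nonnegative real inner products, so that the squared modulus of a
    nonnegative combination of them is at least the sum of the squared moduli of
    its terms ([Cmod_sum_sq_ge]).  Letting r tend to 1 separates the values of k
    and gives the bound on the sum of all |a_(n,k)|^2 + |b_(n,k)|^2, which is
    part (I) ([coefficients_sq_le]); the individual bound follows from
    (x + y)^2 <= 2 (x^2 + y^2).

    Parseval is obtained without integrals.  A uniform tail estimate for power
    series replaces F by trigonometric polynomials, for which the average of the
    squared modulus over sufficiently many equally spaced points equals the sum of
    the squared moduli of the coefficients ([trigpoly_parseval_C]).

    For (II) and (III), F differs from its linear part
    a_0 + a_(1,1) z + conj(b_(1,1) z) by O(|z|^2), so F_z(0) = a_(1,1) and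
    F_zbar(0) = conj b_(1,1) ([linear_part], [wirtinger_at_0]).  Put
    X = |a_(1,1)|, Y = |b_(1,1)|, s = X + Y and l = |X - Y|, which is lambda_F(0).
    Removing the (1,1) term from the bound of (I) and using
    (x + y)^2 <= 2 (x^2 + y^2) in every other term leaves at most
    2 M^2 - 2 (X^2 + Y^2) = 2 M^2 - s^2 - l^2 ([coefficient_sums_le]).
    In (II) the normalization is s l = 1, and the claimed bounds become
    elementary inequalities between l, 1/l and M ([product_bounds]).
    In (III) it is l = 1, whence X^2 + Y^2 >= 1. *)

(** * Finite sums and roots of unity *)

(* Sums produced by [sum_n] live in the sort of a canonical structure; [ring]
   needs the carrier C itself. *)
Ltac cring := match goal with |- @eq _ ?x ?y => change (@eq C x y); ring end.

Lemma Csum_plus (f g : nat -> C) (n : nat) :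
  sum_n (fun k => (f k + g k)%C) n = (sum_n f n + sum_n g n)%C.
Proof. exact (sum_n_plus f g n). Qed.

Lemma Csum_scal (c : C) (f : nat -> C) (n : nat) :
  sum_n (fun k => (c * f k)%C) n = (c * sum_n f n)%C.
Proof. exact (sum_n_mult_l (K := C_Ring) c f n). Qed.

Lemma Csum_Sn (f : nat -> C) (n : nat) :
  sum_n f (S n) = (sum_n f n + f (S n))%C.
Proof. exact (sum_Sn f n). Qed.

Lemma Rsum_Sn (f : nat -> R) (n : nat) :
  sum_n f (S n) = sum_n f n + f (S n).
Proof. exact (sum_Sn f n). Qed.

Lemma Csum_conj (f : nat -> C) (n : nat) :
  sum_n (fun k => Cconj (f k)) n = Cconj (sum_n f n).
Proof.
induction n as [|n IH].
- now rewrite !sum_O.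
- now rewrite !Csum_Sn, IH, Cplus_conj.
Qed.

Lemma Csum_RtoC (f : nat -> R) (n : nat) :
  sum_n (fun k => RtoC (f k)) n = RtoC (sum_n f n).
Proof.
induction n as [|n IH].
- now rewrite !sum_O.
- now rewrite Csum_Sn, Rsum_Sn, IH, RtoC_plus.
Qed.

Lemma Csum_const (c : C) (n : nat) :
  sum_n (fun _ => c) n = (RtoC (INR (S n)) * c)%C.
Proof.
induction n as [|n IH].
- rewrite sum_O. simpl INR. cring.
- rewrite Csum_Sn, IH, (S_INR (S n)), RtoC_plus. cring.
Qed.

Definition expi (t : R) : C := (cos t, sin t).

Lemma expi_plus (s t : R) : expi (s + t) = (expi s * expi t)%C.
Proof.
unfold expi, Cmult; simpl. rewrite cos_plus, sin_plus. f_equal; ring.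
Qed.

Lemma expi_conj (t : R) : Cconj (expi t) = expi (- t).
Proof. unfold expi, Cconj; simpl. now rewrite cos_neg, sin_neg. Qed.

Lemma expi_0 : expi 0 = RtoC 1.
Proof. unfold expi. now rewrite cos_0, sin_0. Qed.

Lemma expi_opp_r (t : R) : (expi t * expi (- t))%C = RtoC 1.
Proof. rewrite <- expi_plus, Rplus_opp_r. exact expi_0. Qed.

Lemma Cmod_expi (t : R) : Cmod (expi t) = 1.
Proof.
unfold Cmod, expi; simpl fst; simpl snd.
replace (cos t ^ 2 + sin t ^ 2) with 1.
- exact sqrt_1.
- generalize (sin2_cos2 t); unfold Rsqr; lra.
Qed.

Lemma expi_pow (t : R) (n : nat) : (expi t ^ n)%C = expi (INR n * t).
Proof.
induction n as [|n IH].
- simpl INR. rewrite Rmult_0_l, expi_0. reflexivity.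
- rewrite Cpow_S, IH, <- expi_plus, S_INR. f_equal; ring.
Qed.

Lemma expi_neq_1 (x : R) : x <> 0 -> -(2 * PI) < x < 2 * PI -> expi x <> RtoC 1.
Proof.
intros Hx Hb E. apply (f_equal fst) in E; simpl in E.
replace x with (2 * (x / 2)) in E by field.
rewrite cos_2a_sin in E.
assert (Hs : sin (x / 2) = 0) by nra.
destruct (Rlt_le_dec 0 x) as [Hp | Hn].
- assert (0 < sin (x / 2)) by (apply sin_gt_0; lra). lra.
- assert (0 < sin (- (x / 2))) by (apply sin_gt_0; lra).
  rewrite sin_neg in H. lra.
Qed.

(** The arguments of the (Q+1)-th roots of unity. *)
Definition node (Q j : nat) : R := 2 * PI * INR j / INR (S Q).

(** A geometric sum: multiplied by w - 1 it telescopes to w^(Q+1) - 1 = 0, and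
    the ratio w = exp(2 pi i m / (Q+1)) is not 1 because |m| < Q + 1. *)
Lemma sum_character (Q : nat) (m : Z) : m <> 0%Z ->
  (Z.abs m < Z.of_nat (S Q))%Z ->
  sum_n (fun j => expi (IZR m * node Q j)) Q = RtoC 0.
Proof.
intros Hm Hb.
assert (HQ : 0 < INR (S Q)) by (apply lt_0_INR; lia).
assert (Hpi := PI_RGT_0).
set (x := IZR m * (2 * PI / INR (S Q))).
assert (Hgeo : forall n,
  ((expi x - RtoC 1) * sum_n (fun j => expi (IZR m * node Q j)) n)%C
  = (expi (INR (S n) * x) - RtoC 1)%C).
{ induction n as [|n IH].
  - rewrite sum_O. unfold node. simpl (INR 0). simpl (INR 1).
    replace (IZR m * (2 * PI * 0 / INR (S Q))) with 0 by (field; lra).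
    rewrite expi_0, Rmult_1_l. cring.
  - rewrite Csum_Sn, Cmult_plus_distr_l, IH.
    replace (IZR m * node Q (S n)) with (INR (S n) * x)
      by (unfold node, x; field; lra).
    rewrite (S_INR (S n)), Rmult_plus_distr_r, Rmult_1_l, expi_plus. cring. }
assert (Hx1 : expi x <> RtoC 1).
{ assert (Hlt : -1 < IZR m / INR (S Q) < 1).
  { rewrite INR_IZR_INZ in *.
    split.
    - apply Rmult_lt_reg_r with (IZR (Z.of_nat (S Q))); [exact HQ|].
      unfold Rdiv. rewrite Rmult_assoc, Rinv_l, Rmult_1_r by lra.
      replace (-1 * IZR (Z.of_nat (S Q))) with (IZR (- Z.of_nat (S Q)))
        by (rewrite opp_IZR; ring).
      apply IZR_lt. lia.
    - apply Rmult_lt_reg_r with (IZR (Z.of_nat (S Q))); [exact HQ|].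
      unfold Rdiv. rewrite Rmult_assoc, Rinv_l, Rmult_1_r, Rmult_1_l by lra.
      apply IZR_lt. lia. }
  assert (Hnz : IZR m / INR (S Q) <> 0).
  { unfold Rdiv. apply Rmult_integral_contrapositive_currified.
    - now apply eq_IZR_contrapositive.
    - apply Rinv_neq_0_compat; lra. }
  replace x with (2 * PI * (IZR m / INR (S Q))) by (unfold x; field; lra).
  apply expi_neq_1.
  - apply Rmult_integral_contrapositive_currified; lra.
  - nra. }
assert (Hend : expi (INR (S Q) * x) = RtoC 1).
{ replace (INR (S Q) * x) with (2 * IZR m * PI) by (unfold x; field; lra).
  unfold expi, RtoC. f_equal.
  - replace (2 * IZR m * PI) with (2 * (IZR m * PI)) by ring.
    rewrite cos_2a_sin, (sin_eq_0_1 (IZR m * PI)) by now exists m. ring.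
  - apply sin_eq_0_1. exists (2 * m)%Z. now rewrite mult_IZR. }
specialize (Hgeo Q). rewrite Hend in Hgeo.
replace (RtoC 1 - RtoC 1)%C with (RtoC 0) in Hgeo by ring.
destruct (Ceq_dec (sum_n (fun j => expi (IZR m * node Q j)) Q) (RtoC 0)) as [E|E];
  [exact E|].
exfalso. revert Hgeo. apply Cmult_neq_0; [|exact E].
now apply Cminus_eq_contra.
Qed.

(** The index n stands for the frequencies n + 1 and - (n + 1): both families of
    coefficients start after the constant term. *)
Definition trigpoly (c : C) (A B : nat -> C) (N : nat) (t : R) : C :=
  (c + sum_n (fun n => A n * expi (IZR (Z.of_nat (S n)) * t)
                     + B n * expi (- (IZR (Z.of_nat (S n)) * t)))%C N)%C.

Lemma trigpoly_S c A B N t :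
  trigpoly c A B (S N) t = (trigpoly c A B N t
     + A (S N) * expi (IZR (Z.of_nat (S (S N))) * t)
     + B (S N) * expi (- (IZR (Z.of_nat (S (S N))) * t)))%C.
Proof. unfold trigpoly. rewrite Csum_Sn. cring. Qed.

Lemma sum_character_pair (x y : C) (Q : nat) (m l : Z) :
  (m + l)%Z <> 0%Z -> (m - l)%Z <> 0%Z ->
  (Z.abs (m + l) < Z.of_nat (S Q))%Z -> (Z.abs (m - l) < Z.of_nat (S Q))%Z ->
  sum_n (fun j => (x * expi (IZR l * node Q j) + y * expi (- (IZR l * node Q j)))
                  * expi (IZR m * node Q j))%C Q = RtoC 0.
Proof.
intros H1 H2 H3 H4.
rewrite (sum_n_ext _ (fun j => x * expi (IZR (m + l) * node Q j)
   + y * expi (IZR (m - l) * node Q j))%C).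
- rewrite Csum_plus, !Csum_scal, !sum_character by assumption. cring.
- intros j. rewrite plus_IZR, minus_IZR.
  replace ((IZR m + IZR l) * node Q j) with (IZR l * node Q j + IZR m * node Q j) by ring.
  replace ((IZR m - IZR l) * node Q j) with (- (IZR l * node Q j) + IZR m * node Q j) by ring.
  rewrite !expi_plus. cring.
Qed.

(** All frequencies of the product are nonzero and smaller than Q + 1 in absolute
    value, so none of them is aliased to the constant one. *)
Lemma trigpoly_orthogonal c A B (Q N : nat) (m : Z) :
  (Z.of_nat (S N) < Z.abs m)%Z ->
  (Z.abs m + Z.of_nat (S N) < Z.of_nat (S Q))%Z ->
  sum_n (fun j => trigpoly c A B N (node Q j) * expi (IZR m * node Q j))%C Q = RtoC 0.
Proof.
induction N as [|N IH]; intros H1 H2.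
- rewrite (sum_n_ext _ (fun j => c * expi (IZR m * node Q j) +
    (A 0%nat * expi (IZR (Z.of_nat 1) * node Q j)
     + B 0%nat * expi (- (IZR (Z.of_nat 1) * node Q j))) * expi (IZR m * node Q j))%C).
  + rewrite Csum_plus, Csum_scal, sum_character, sum_character_pair by lia. cring.
  + intros j. unfold trigpoly. rewrite sum_O. cring.
- rewrite (sum_n_ext _ (fun j =>
    trigpoly c A B N (node Q j) * expi (IZR m * node Q j) +
    (A (S N) * expi (IZR (Z.of_nat (S (S N))) * node Q j)
     + B (S N) * expi (- (IZR (Z.of_nat (S (S N))) * node Q j)))
    * expi (IZR m * node Q j))%C).
  + rewrite Csum_plus, IH, sum_character_pair by lia. cring.
  + intros j. rewrite trigpoly_S. cring.
Qed.

(** By induction on N: adding the frequencies N + 2 and - (N + 2) produces cross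
    terms with what is already there and with each other, and [2 * S N < S Q]
    makes each of them average to zero. *)
Lemma trigpoly_parseval_C c A B (Q N : nat) :
  (2 * S N < S Q)%nat ->
  sum_n (fun j => trigpoly c A B N (node Q j) * Cconj (trigpoly c A B N (node Q j)))%C Q
  = (RtoC (INR (S Q)) * (c * Cconj c
       + sum_n (fun n => A n * Cconj (A n) + B n * Cconj (B n)) N))%C.
Proof.
(* The effect of adjoining one pair of opposite frequencies, orthogonal to P. *)
assert (Hstep : forall (P : R -> C) x y (m : Z) (S0 : C),
  (0 < m)%Z -> (2 * m < Z.of_nat (S Q))%Z ->
  sum_n (fun j => P (node Q j) * expi (IZR m * node Q j))%C Q = RtoC 0 ->
  sum_n (fun j => P (node Q j) * expi (IZR (- m) * node Q j))%C Q = RtoC 0 ->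
  sum_n (fun j => P (node Q j) * Cconj (P (node Q j)))%C Q = S0 ->
  sum_n (fun j => (P (node Q j) + x * expi (IZR m * node Q j)
                   + y * expi (- (IZR m * node Q j)))
      * Cconj (P (node Q j) + x * expi (IZR m * node Q j)
                   + y * expi (- (IZR m * node Q j))))%C Q
  = (S0 + RtoC (INR (S Q)) * (x * Cconj x + y * Cconj y))%C).
{ intros P x y m S0 Hm1 Hm2 E1 E2 E0.
  (* w is kept opaque, so that linearity does not split the constant term. *)
  assert (Hw : exists w, w = (x * Cconj x + y * Cconj y)%C) by now eexists.
  destruct Hw as [w Hw]. rewrite <- Hw.
  rewrite (sum_n_ext _ (fun j =>
     P (node Q j) * Cconj (P (node Q j))
     + (w
     + (Cconj x * (P (node Q j) * expi (IZR (- m) * node Q j))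
     + (Cconj y * (P (node Q j) * expi (IZR m * node Q j))
     + (x * Cconj (P (node Q j) * expi (IZR (- m) * node Q j))
     + (y * Cconj (P (node Q j) * expi (IZR m * node Q j))
     + (x * Cconj y * expi (IZR (2 * m) * node Q j)
     + y * Cconj x * expi (IZR (- (2 * m)) * node Q j))))))))%C).
  - rewrite !Csum_plus, !Csum_scal, !Csum_conj, E0, E1, E2, !Csum_const.
    rewrite !sum_character by lia.
    replace (Cconj (RtoC 0)) with (RtoC 0)
      by (unfold Cconj, RtoC; simpl; now rewrite Ropp_0).
    cring.
  - intros j. set (p := P (node Q j)).
    replace (IZR (- m) * node Q j) with (- (IZR m * node Q j)) by (rewrite opp_IZR; ring).
    replace (IZR (2 * m) * node Q j) with (IZR m * node Q j + IZR m * node Q j)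
      by (rewrite mult_IZR; ring).
    replace (IZR (- (2 * m)) * node Q j) with (- (IZR m * node Q j) + - (IZR m * node Q j))
      by (rewrite opp_IZR, mult_IZR; ring).
    rewrite !Cplus_conj, !Cmult_conj, !expi_conj, !expi_plus, !Ropp_involutive.
    assert (Huv := expi_opp_r (IZR m * node Q j)).
    set (u := expi (IZR m * node Q j)) in *.
    set (v := expi (- (IZR m * node Q j))) in *.
    rewrite <- (Cmult_1_l w), <- Huv, Hw. cring. }
induction N as [|N IH]; intros HN.
- rewrite sum_O. unfold trigpoly.
  rewrite (sum_n_ext _ (fun j =>
     (c + A 0%nat * expi (IZR 1 * node Q j) + B 0%nat * expi (- (IZR 1 * node Q j)))
      * Cconj (c + A 0%nat * expi (IZR 1 * node Q j)
                 + B 0%nat * expi (- (IZR 1 * node Q j))))%C).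
  + rewrite (Hstep (fun _ => c) _ _ 1%Z (RtoC (INR (S Q)) * (c * Cconj c))%C);
      try lia; rewrite ?Csum_scal, ?sum_character by lia; rewrite ?Csum_const; cring.
  + intros j. rewrite !sum_O. simpl Z.of_nat. rewrite <- !Cplus_assoc. reflexivity.
- rewrite Csum_Sn.
  rewrite (sum_n_ext _ (fun j =>
     (trigpoly c A B N (node Q j)
      + A (S N) * expi (IZR (Z.of_nat (S (S N))) * node Q j)
      + B (S N) * expi (- (IZR (Z.of_nat (S (S N))) * node Q j)))
     * Cconj (trigpoly c A B N (node Q j)
      + A (S N) * expi (IZR (Z.of_nat (S (S N))) * node Q j)
      + B (S N) * expi (- (IZR (Z.of_nat (S (S N))) * node Q j))))%C)
    by (intros j; now rewrite trigpoly_S).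
  rewrite (Hstep (trigpoly c A B N) (A (S N)) (B (S N)) (Z.of_nat (S (S N)))
    (RtoC (INR (S Q)) * (c * Cconj c
       + sum_n (fun n => A n * Cconj (A n) + B n * Cconj (B n)) N))%C);
    [cring | lia | lia | apply trigpoly_orthogonal; lia
    | apply trigpoly_orthogonal; lia | apply IH; lia].
Qed.

Lemma trigpoly_parseval_le c A B (N : nat) (K : R) :
  (forall t, Cmod (trigpoly c A B N t) <= K) ->
  Cmod c ^ 2 + sum_n (fun n => Cmod (A n) ^ 2 + Cmod (B n) ^ 2) N <= K ^ 2.
Proof.
intros HK. set (Q := (2 * S N)%nat).
assert (HQ : 0 < INR (S Q)) by (apply lt_0_INR; lia).
assert (E := trigpoly_parseval_C c A B Q N ltac:(unfold Q; lia)).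
rewrite <- Cmod2_conj in E.
rewrite (sum_n_ext _ (fun j => RtoC (Cmod (trigpoly c A B N (node Q j)) ^ 2))) in E
  by (intros; symmetry; apply Cmod2_conj).
rewrite (sum_n_ext (fun n => A n * Cconj (A n) + B n * Cconj (B n))%C
  (fun n => RtoC (Cmod (A n) ^ 2 + Cmod (B n) ^ 2))) in E
  by (intros; rewrite RtoC_plus; now rewrite !Cmod2_conj).
rewrite !Csum_RtoC, <- RtoC_plus, <- RtoC_mult in E. apply RtoC_inj in E.
apply Rmult_le_reg_l with (INR (S Q)); [exact HQ|]. rewrite <- E.
replace (INR (S Q) * K ^ 2) with (sum_n (fun _ => K ^ 2) Q) by (apply sum_n_const).
apply sum_n_m_le. intros j. apply pow_incr. split; [apply Cmod_ge_0 | apply HK].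
Qed.

(** * Tails of power series *)

Lemma Cmod_sum_le (f : nat -> C) (n : nat) :
  Cmod (sum_n f n) <= sum_n (fun k => Cmod (f k)) n.
Proof.
induction n as [|n IH].
- rewrite !sum_O. apply Rle_refl.
- rewrite Csum_Sn, Rsum_Sn.
  eapply Rle_trans; [apply Cmod_triangle | lra].
Qed.

Lemma Cseries_eventually (u : nat -> C) (l : C) :
  @is_series C_AbsRing C_NormedModule u l ->
  forall eps, 0 < eps -> exists N, forall n, (N <= n)%nat ->
    Cmod (sum_n u n - l) < eps.
Proof.
intros H eps Heps.
destruct (H _ (locally_le_locally_norm l _ (locally_norm_ball_norm l (mkposreal eps Heps))))
  as [N HN].
exists N. exact HN.
Qed.

Lemma Cseries_le (u : nat -> C) (l c : C) (N : nat) (K : R) :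
  @is_series C_AbsRing C_NormedModule u l ->
  (forall n, (N <= n)%nat -> Cmod (sum_n u n - c) <= K) -> Cmod (l - c) <= K.
Proof.
intros H HK. apply le_epsilon. intros eps Heps.
destruct (Cseries_eventually u l H eps Heps) as [N' HN'].
specialize (HN' (N + N')%nat ltac:(lia)). specialize (HK (N + N')%nat ltac:(lia)).
replace (l - c)%C with ((sum_n u (N + N') - c) + - (sum_n u (N + N') - l))%C by cring.
eapply Rle_trans; [apply Cmod_triangle|]. rewrite Cmod_opp. lra.
Qed.

Lemma Cseries_terms_bounded (u : nat -> C) (l : C) :
  @is_series C_AbsRing C_NormedModule u l ->
  exists K, 0 <= K /\ forall n, Cmod (u n) <= K.
Proof.
intros H.
destruct (filterlim_bounded (K := C_AbsRing) (V := C_NormedModule) (sum_n u)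
  (ex_intro _ l H)) as [K HK].
assert (HK' : forall n, Cmod (sum_n u n) <= K) by exact HK.
assert (K0 : 0 <= K) by (eapply Rle_trans; [apply Cmod_ge_0 | apply (HK' 0%nat)]).
exists (2 * K). split; [lra|]. intros [|n].
- specialize (HK' 0%nat). rewrite sum_O in HK'. lra.
- replace (u (S n)) with (sum_n u (S n) + - sum_n u n)%C
    by (rewrite Csum_Sn; cring).
  eapply Rle_trans; [apply Cmod_triangle|]. rewrite Cmod_opp.
  generalize (HK' n) (HK' (S n)). lra.
Qed.

(** The terms are bounded at the point rho, hence dominated at z by a geometric
    series of ratio |z| / rho.  The power of the ratio is kept explicit: it gives
    uniform convergence on circles as well as the order of vanishing at 0. *)
Lemma power_series_tail (c : nat -> C) (f : C -> C) (rho : R) :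
  0 < rho < 1 ->
  (forall z, Cmod z < 1 ->
     @is_series C_AbsRing C_NormedModule (fun n => (c n * z ^ S n)%C) (f z)) ->
  exists K, 0 <= K /\ forall z N, Cmod z < rho ->
    Cmod (f z - sum_n (fun n => c n * z ^ S n)%C N)
      <= K * (Cmod z / rho) ^ S (S N) / (1 - Cmod z / rho).
Proof.
intros Hr H.
destruct (Cseries_terms_bounded _ _ (H (RtoC rho) ltac:(rewrite Cmod_R, Rabs_pos_eq; lra)))
  as [K [K0 HK]].
exists K. split; [exact K0|]. intros z N Hz.
set (q := Cmod z / rho).
assert (Hq : 0 <= q < 1).
{ split; unfold q.
  - apply Rdiv_le_0_compat; [apply Cmod_ge_0 | lra].
  - apply Rlt_div_l; lra. }
assert (Hterm : forall n, Cmod (c n * z ^ S n) <= K * q ^ S n).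
{ intros n. rewrite Cmod_mult, Cmod_pow.
  replace (Cmod z) with (rho * q) by (unfold q; field; lra).
  rewrite Rpow_mult_distr, <- Rmult_assoc.
  apply Rmult_le_compat_r; [apply pow_le; lra|].
  eapply Rle_trans; [|apply (HK n)].
  rewrite Cmod_mult, Cmod_pow, Cmod_R, (Rabs_pos_eq rho) by lra. apply Rle_refl. }
apply (Cseries_le (fun n => c n * z ^ S n)%C _ _ N _ (H z ltac:(lra))).
assert (Hd : forall d,
  Cmod (sum_n (fun n => c n * z ^ S n)%C (N + d) - sum_n (fun n => c n * z ^ S n)%C N)
  <= K * (q ^ S (S N) - q ^ S (S (N + d))) / (1 - q)).
{ induction d as [|d IH].
  - rewrite Nat.add_0_r.
    match goal with |- Cmod ?x <= _ => replace x with (RtoC 0) by cring end.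
    rewrite Cmod_0. right. field. lra.
  - rewrite Nat.add_succ_r, Csum_Sn.
    match goal with |- Cmod (?x + ?y - ?w) <= _ =>
      replace (x + y - w)%C with ((x - w) + y)%C by cring end.
    eapply Rle_trans; [apply Cmod_triangle|].
    eapply Rle_trans; [apply Rplus_le_compat; [exact IH | apply Hterm]|].
    right. simpl. field. lra. }
intros n Hn. replace n with (N + (n - N))%nat by lia.
eapply Rle_trans; [apply Hd|].
apply Rmult_le_compat_r; [left; apply Rinv_0_lt_compat; lra|].
apply Rmult_le_compat_l; [exact K0|].
assert (0 <= q ^ S (S (N + (n - N)))) by (apply pow_le; lra). lra.
Qed.

Lemma power_series_uniform (c : nat -> C) (f : C -> C) (r eps : R) :
  0 <= r < 1 -> 0 < eps ->
  (forall z, Cmod z < 1 ->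
     @is_series C_AbsRing C_NormedModule (fun n => (c n * z ^ S n)%C) (f z)) ->
  exists N0, forall N z, (N0 <= N)%nat -> Cmod z = r ->
    Cmod (f z - sum_n (fun n => c n * z ^ S n)%C N) <= eps.
Proof.
intros Hr Heps H.
destruct (power_series_tail c f ((1 + r) / 2) ltac:(lra) H) as [K [K0 HK]].
set (q := r / ((1 + r) / 2)) in *.
assert (Hq : 0 <= q < 1).
{ split; unfold q.
  - apply Rdiv_le_0_compat; lra.
  - apply Rlt_div_l; lra. }
destruct (pow_lt_1_zero q ltac:(rewrite Rabs_pos_eq; lra) (eps * (1 - q) / (K + 1)))
  as [N0 HN0].
{ apply Rdiv_lt_0_compat; [apply Rmult_lt_0_compat|]; lra. }
exists N0. intros N z HN Hz.
eapply Rle_trans; [apply HK; lra|].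
rewrite Hz. fold q.
specialize (HN0 (S (S N)) ltac:(lia)).
assert (Hp : 0 <= q ^ S (S N)) by (apply pow_le; lra).
rewrite Rabs_pos_eq in HN0 by exact Hp.
apply Rle_div_l; [lra|].
apply Rlt_div_r in HN0; [|lra]. nra.
Qed.

(** The tail estimate with rho = 1/2 and a single term kept. *)
Lemma power_series_linear (c : nat -> C) (f : C -> C) :
  (forall z, Cmod z < 1 ->
     @is_series C_AbsRing C_NormedModule (fun n => (c n * z ^ S n)%C) (f z)) ->
  exists K, 0 <= K /\ forall z, Cmod z <= / 4 ->
    Cmod (f z - c 0%nat * z) <= K * Cmod z ^ 2.
Proof.
intros H.
destruct (power_series_tail c f (/ 2) ltac:(lra) H) as [K [K0 HK]].
exists (8 * K). split; [lra|]. intros z Hz.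
specialize (HK z 0%nat ltac:(lra)). rewrite sum_O, Cpow_1_r in HK.
eapply Rle_trans; [exact HK|].
assert (Hm := Cmod_ge_0 z). set (m := Cmod z) in *.
replace (m / / 2) with (2 * m) by field.
apply Rle_div_l; [lra|]. 
assert (0 <= K * m ^ 2) by (apply Rmult_le_pos; nra).
simpl in *. nra.
Qed.

Lemma exists_uniform_threshold (P : nat -> nat -> Prop) (q : nat) :
  (forall k, (k <= q)%nat -> exists N0, forall N, (N0 <= N)%nat -> P k N) ->
  exists N0, forall k N, (k <= q)%nat -> (N0 <= N)%nat -> P k N.
Proof.
induction q as [|q IH]; intros H.
- destruct (H 0%nat ltac:(lia)) as [N0 HN0]. exists N0. intros k N Hk.
  replace k with 0%nat by lia. apply HN0.
- destruct IH as [N1 H1]; [intros k Hk; apply H; lia|].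
  destruct (H (S q) ltac:(lia)) as [N2 H2].
  exists (max N1 N2). intros k N Hk HN.
  destruct (Nat.eq_dec k (S q)) as [->|E]; [apply H2 | apply H1]; lia.
Qed.

(** * Sums of vectors at acute angles *)

Lemma sum_n_le_loc (f g : nat -> R) (n : nat) :
  (forall k, (k <= n)%nat -> f k <= g k) -> sum_n f n <= sum_n g n.
Proof.
induction n as [|n IH]; intros H.
- rewrite !sum_O. now apply H.
- rewrite !Rsum_Sn. apply Rplus_le_compat; [apply IH; intros; apply H; lia | apply H; lia].
Qed.

Lemma sum_n_nonneg (f : nat -> R) (n : nat) :
  (forall k, 0 <= f k) -> 0 <= sum_n f n.
Proof.
intros H. induction n as [|n IH].
- now rewrite sum_O.
- rewrite Rsum_Sn. generalize (H (S n)). lra.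
Qed.

(** The argument condition in the form used below: x * conj y is a positive
    multiple of x / y, whose argument has nonnegative cosine. *)
Lemma Re_mul_conj_nonneg (x y : C) :
  (x <> RtoC 0 -> y <> RtoC 0 -> Rabs (Carg (x / y)%C) <= PI / 2) ->
  0 <= Re (x * Cconj y)%C.
Proof.
intros H.
destruct (Ceq_dec x (RtoC 0)) as [->|Hx].
{ rewrite Cmult_0_l. apply Rle_refl. }
destruct (Ceq_dec y (RtoC 0)) as [->|Hy].
{ right. simpl. ring. }
specialize (H Hx Hy).
assert (Hq : (x / y)%C <> RtoC 0).
{ unfold Cdiv. apply Cmult_neq_0; [exact Hx|].
  intros E. apply C1_nz. now rewrite <- (Cinv_r y Hy), E, Cmult_0_r. }
destruct (Carg_spec _ Hq) as [_ E].
apply Rabs_le_between in H.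
assert (Hcos := cos_ge_0 (Carg (x / y)%C) ltac:(lra) ltac:(lra)).
replace (x * Cconj y)%C with (RtoC (Cmod y ^ 2) * (x / y))%C
  by (rewrite Cmod2_conj; field; exact Hy).
rewrite E, !re_scal_l. simpl Re.
apply Rmult_le_pos; [apply pow2_ge_0|].
apply Rmult_le_pos; [apply Cmod_ge_0 | exact Hcos].
Qed.

Lemma Cmod_plus_sq (x y : C) :
  Cmod (x + y) ^ 2 = Cmod x ^ 2 + Cmod y ^ 2 + 2 * Re (x * Cconj y)%C.
Proof. rewrite !Cmod2_alt. destruct x, y; simpl. ring. Qed.

Lemma Cmod_sum_sq_ge (x : nat -> C) (q : nat) :
  (forall i j, (i <= q)%nat -> (j <= q)%nat -> 0 <= Re (x i * Cconj (x j))%C) ->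
  sum_n (fun k => Cmod (x k) ^ 2) q <= Cmod (sum_n x q) ^ 2.
Proof.
induction q as [|q IH]; intros H.
- rewrite !sum_O. apply Rle_refl.
- rewrite Csum_Sn, Rsum_Sn, Cmod_plus_sq.
  assert (Hre : forall i, (i <= q)%nat -> 0 <= Re (sum_n x i * Cconj (x (S q)))%C).
  { induction i as [|i IHi]; intros Hi.
    - rewrite sum_O. apply H; lia.
    - rewrite Csum_Sn, Cmult_plus_distr_r, re_plus.
      specialize (IHi ltac:(lia)). specialize (H (S i) (S q) ltac:(lia) ltac:(lia)). lra. }
  specialize (Hre q ltac:(lia)).
  assert (Hq := IH (fun i j Hi Hj => H i j ltac:(lia) ltac:(lia))). lra.
Qed.

Lemma weighted_term_sq (w r : R) (x : C) (n : nat) :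
  Cmod (RtoC w * (x * RtoC r ^ n))%C ^ 2 = (w * r ^ n) ^ 2 * Cmod x ^ 2.
Proof.
rewrite <- RtoC_pow, !Cmod_mult, !Cmod_R, !Rpow_mult_distr, !pow2_abs. ring.
Qed.

(** The weight of the k-th vector is r^(2k+n); the smallest of these weights is
    at least r^m, which decouples the estimate from k before r tends to 1. *)
Lemma weighted_sum_sq_ge (x : nat -> C) (r : R) (n m q : nat) :
  0 <= r <= 1 -> (2 * q + n <= m)%nat ->
  (forall i j, (i <= q)%nat -> (j <= q)%nat -> 0 <= Re (x i * Cconj (x j))%C) ->
  (r ^ m) ^ 2 * sum_n (fun k => Cmod (x k) ^ 2) q
    <= Cmod (sum_n (fun k => RtoC (r ^ (2 * k)) * (x k * RtoC r ^ n))%C q) ^ 2.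
Proof.
intros Hr Hm H.
eapply Rle_trans; [|apply Cmod_sum_sq_ge].
- rewrite <- (sum_n_mult_l (K := R_Ring)).
  apply sum_n_le_loc.
  intros k Hk. rewrite weighted_term_sq.
  apply Rmult_le_compat_r; [apply pow2_ge_0|].
  rewrite <- pow_add. apply pow_incr.
  split; [apply pow_le; lra|].
  replace m with ((2 * k + n) + (m - (2 * k + n)))%nat by lia.
  rewrite (pow_add r (2 * k + n)).
  rewrite <- (Rmult_1_r (r ^ (2 * k + n))) at 2.
  apply Rmult_le_compat_l; [apply pow_le; lra|].
  rewrite <- (pow1 (m - (2 * k + n))). apply pow_incr. lra.
- intros i j Hi Hj.
  rewrite <- !RtoC_pow, !Cmult_conj.
  replace (RtoC (r ^ (2 * i)) * (x i * RtoC (r ^ n)) *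
    (Cconj (RtoC (r ^ (2 * j))) * (Cconj (x j) * Cconj (RtoC (r ^ n)))))%C
    with (RtoC (r ^ (2 * i) * r ^ n * r ^ (2 * j) * r ^ n) * (x i * Cconj (x j)))%C.
  + rewrite re_scal_l. apply Rmult_le_pos; [|now apply H].
    repeat apply Rmult_le_pos; apply pow_le; lra.
  + assert (Hc : forall s, Cconj (RtoC s) = RtoC s)
      by (intros s; unfold Cconj, RtoC; simpl; now rewrite Ropp_0).
    rewrite !Hc, !RtoC_mult. ring.
Qed.

(** * Parseval's inequality for a bounded expansion *)

Section Expansion.

Variables (q : nat) (F : C -> C) (a0 : C) (a b : nat -> nat -> C) (h g : nat -> C -> C).

Hypothesis series_h : forall k, (k <= q)%nat -> forall z, Cmod z < 1 ->
  @is_series C_AbsRing C_NormedModule (fun n => (a n k * z ^ S n)%C) (h k z).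
Hypothesis series_g : forall k, (k <= q)%nat -> forall z, Cmod z < 1 ->
  @is_series C_AbsRing C_NormedModule (fun n => (b n k * z ^ S n)%C) (g k z).
Hypothesis F_form : forall z, Cmod z < 1 ->
  F z = (a0 + sum_n (fun k => RtoC (Cmod z ^ (2 * k)) * (h k z + Cconj (g k z))) q)%C.

(** The Fourier coefficients of F on the circle of radius r, for the frequencies
    n + 1 ([circle_coeff_a]) and - (n + 1) ([circle_coeff_b]). *)
Definition circle_coeff_a (r : R) (n : nat) : C :=
  sum_n (fun k => RtoC (r ^ (2 * k)) * (a n k * RtoC r ^ S n))%C q.
Definition circle_coeff_b (r : R) (n : nat) : C :=
  sum_n (fun k => RtoC (r ^ (2 * k)) * (Cconj (b n k) * RtoC r ^ S n))%C q.

Lemma truncation_is_trigpoly (r t : R) (N : nat) :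
  (a0 + sum_n (fun k => RtoC (r ^ (2 * k)) *
     (sum_n (fun n => a n k * (RtoC r * expi t) ^ S n) N
      + Cconj (sum_n (fun n => b n k * (RtoC r * expi t) ^ S n) N))) q)%C
  = trigpoly a0 (circle_coeff_a r) (circle_coeff_b r) N t.
Proof.
unfold trigpoly. f_equal.
rewrite (sum_n_ext _ (fun k => sum_n (fun n =>
    RtoC (r ^ (2 * k)) * (a n k * RtoC r ^ S n) * expi (IZR (Z.of_nat (S n)) * t)
    + RtoC (r ^ (2 * k)) * (Cconj (b n k) * RtoC r ^ S n)
      * expi (- (IZR (Z.of_nat (S n)) * t)))%C N)).
- rewrite sum_n_switch. apply sum_n_ext. intros n. unfold circle_coeff_a, circle_coeff_b.
  rewrite Csum_plus, <- !(Cmult_comm (expi _)), <- !Csum_scal.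
  apply (f_equal2 Cplus); apply sum_n_ext; intros k; cring.
- intros k. rewrite <- Csum_conj, <- Csum_plus, <- Csum_scal.
  apply sum_n_ext. intros n.
  rewrite !Cpow_mult_l, expi_pow, !Cmult_conj, expi_conj, Cpow_conj, <- INR_IZR_INZ.
  replace (Cconj (RtoC r)) with (RtoC r)
    by (unfold Cconj, RtoC; simpl; now rewrite Ropp_0).
  cring.
Qed.

(** F is within eps of its truncations, uniformly on the circle, so that these
    trigonometric polynomials are bounded by M + eps; the coefficients with index
    at most N are among theirs. *)
Lemma circle_parseval_le (M r : R) (N : nat) :
  (forall z, Cmod z < 1 -> Cmod (F z) <= M) -> 0 <= r < 1 ->
  Cmod a0 ^ 2 + sum_n (fun n => Cmod (circle_coeff_a r n) ^ 2 + Cmod (circle_coeff_b r n) ^ 2) N <= M ^ 2.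
Proof.
intros HM Hr.
assert (M0 : 0 <= M).
{ eapply Rle_trans; [apply Cmod_ge_0 | apply (HM (RtoC 0))]. rewrite Cmod_0. lra. }
set (X := Cmod a0 ^ 2 + _).
cut (forall eps, 0 < eps -> X <= (M + eps) ^ 2).
{ intros HX. apply le_epsilon. intros e He.
  assert (He' : 0 < Rmin 1 (e / (2 * M + 1))).
  { apply Rmin_pos; [lra|]. apply Rdiv_lt_0_compat; lra. }
  eapply Rle_trans; [apply (HX _ He')|].
  set (d := Rmin _ _) in *.
  assert (d <= 1) by apply Rmin_l.
  assert (Hd : d <= e / (2 * M + 1)) by apply Rmin_r.
  apply Rle_div_r in Hd; [|lra]. nra. }
intros eps Heps.
assert (Hq : 0 < INR (S q)) by (apply lt_0_INR; lia).
(* There are 2 (q + 1) power series, with weights at most 1. *)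
set (e := eps / (2 * INR (S q))).
assert (He : 0 < e) by (apply Rdiv_lt_0_compat; lra).
destruct (exists_uniform_threshold (fun k N => forall z, Cmod z = r ->
    Cmod (h k z - sum_n (fun n => a n k * z ^ S n)%C N) <= e) q) as [N1 H1].
{ intros k Hk.
  destruct (power_series_uniform (fun n => a n k) (h k) r e Hr He (series_h k Hk)) as [N0 HN0].
  exists N0. intros; now apply HN0. }
destruct (exists_uniform_threshold (fun k N => forall z, Cmod z = r ->
    Cmod (g k z - sum_n (fun n => b n k * z ^ S n)%C N) <= e) q) as [N2 H2].
{ intros k Hk.
  destruct (power_series_uniform (fun n => b n k) (g k) r e Hr He (series_g k Hk)) as [N0 HN0].
  exists N0. intros; now apply HN0. }
(* A truncation long enough for the approximation and containing the first N terms. *)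
set (N' := (N + (N1 + N2))%nat).
apply Rle_trans with (Cmod a0 ^ 2
  + sum_n (fun n => Cmod (circle_coeff_a r n) ^ 2 + Cmod (circle_coeff_b r n) ^ 2) N').
{ unfold X, N'. apply Rplus_le_compat_l.
  generalize (N1 + N2)%nat as d. induction d as [|d IH].
  - rewrite Nat.add_0_r. apply Rle_refl.
  - rewrite Nat.add_succ_r, Rsum_Sn.
    generalize (pow2_ge_0 (Cmod (circle_coeff_a r (S (N + d)))))
      (pow2_ge_0 (Cmod (circle_coeff_b r (S (N + d))))). lra. }
apply trigpoly_parseval_le. intros t.
rewrite <- truncation_is_trigpoly. set (z := (RtoC r * expi t)%C).
assert (Hz : Cmod z = r)
  by (unfold z; rewrite Cmod_mult, Cmod_expi, Cmod_R, Rabs_pos_eq; lra).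
match goal with |- Cmod ?S <= _ => replace S with (F z + (S - F z))%C by cring end.
eapply Rle_trans; [apply Cmod_triangle|].
apply Rplus_le_compat; [apply HM; lra|].
rewrite F_form, Hz by lra.
match goal with |- Cmod (?c + ?s - (?c + ?s')) <= _ =>
  replace (c + s - (c + s'))%C with (s + (- RtoC 1) * s')%C
    by cring end.
rewrite <- Csum_scal, <- Csum_plus.
eapply Rle_trans; [apply Cmod_sum_le|].
replace eps with (INR (S q) * (e + e)) by (unfold e; field; lra).
rewrite <- sum_n_const.
apply sum_n_le_loc. intros k Hk.
set (sa := sum_n (fun n => a n k * z ^ S n)%C N').
set (sb := sum_n (fun n => b n k * z ^ S n)%C N').
replace (RtoC (r ^ (2 * k)) * (sa + Cconj sb)
   + (- RtoC 1) * (RtoC (r ^ (2 * k)) * (h k z + Cconj (g k z))))%C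
  with (RtoC (- r ^ (2 * k)) * ((h k z - sa) + Cconj (g k z - sb)))%C
  by (rewrite Cminus_conj, !RtoC_opp; cring).
rewrite Cmod_mult, Cmod_R, Rabs_Ropp, Rabs_pos_eq by (apply pow_le; lra).
rewrite <- (Rmult_1_l (e + e)).
apply Rmult_le_compat; [apply pow_le; lra | apply Cmod_ge_0 | |].
- rewrite <- (pow1 (2 * k)). apply pow_incr. lra.
- eapply Rle_trans; [apply Cmod_triangle|].
  apply Rplus_le_compat.
  + apply H1; [lia | unfold N'; lia | exact Hz].
  + rewrite Cmod_conj. apply H2; [lia | unfold N'; lia | exact Hz].
Qed.

Hypothesis acute_a : forall n i j, (i <= q)%nat -> (j <= q)%nat ->
  0 <= Re (a n i * Cconj (a n j))%C.
Hypothesis acute_b : forall n i j, (i <= q)%nat -> (j <= q)%nat ->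
  0 <= Re (b n i * Cconj (b n j))%C.

Lemma coefficients_sq_le (M : R) (N : nat) :
  (forall z, Cmod z < 1 -> Cmod (F z) <= M) ->
  Cmod a0 ^ 2
    + sum_n (fun n => sum_n (fun k => Cmod (a n k) ^ 2 + Cmod (b n k) ^ 2) q) N <= M ^ 2.
Proof.
intros HM.
set (X := sum_n _ N). set (m := (2 * q + S N)%nat).
assert (HX : 0 <= X).
{ apply sum_n_nonneg. intros n. apply sum_n_nonneg. intros k.
  generalize (pow2_ge_0 (Cmod (a n k))) (pow2_ge_0 (Cmod (b n k))). lra. }
assert (Hr : forall r, 0 <= r < 1 -> Cmod a0 ^ 2 + (r ^ m) ^ 2 * X <= M ^ 2).
{ intros r Hr. eapply Rle_trans; [|apply (circle_parseval_le M r N HM Hr)].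
  apply Rplus_le_compat_l. unfold X. rewrite <- (sum_n_mult_l (K := R_Ring)).
  apply sum_n_le_loc. intros n Hn.
  rewrite (sum_n_plus (G := R_AbelianMonoid)).
  change ((r ^ m) ^ 2 * (sum_n (fun k => Cmod (a n k) ^ 2) q
     + sum_n (fun k => Cmod (b n k) ^ 2) q)
    <= Cmod (circle_coeff_a r n) ^ 2 + Cmod (circle_coeff_b r n) ^ 2).
  rewrite Rmult_plus_distr_l. apply Rplus_le_compat.
  - apply weighted_sum_sq_ge; [lra | unfold m; lia | apply acute_a].
  - rewrite (sum_n_ext _ (fun k => Cmod (Cconj (b n k)) ^ 2))
      by (intros; now rewrite Cmod_conj).
    apply weighted_sum_sq_ge; [lra | unfold m; lia |].
    intros i j Hi Hj. rewrite Cconj_conj, Cmult_comm. now apply acute_b. }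
(* Pass to the limit r -> 1. *)
assert (Hc : continuity_pt (fun r => Cmod a0 ^ 2 + (r ^ m) ^ 2 * X) 1) by reg.
destruct (Rle_lt_dec (Cmod a0 ^ 2 + X) (M ^ 2)) as [Hle|Hlt]; [exact Hle|].
exfalso.
destruct (Hc (Cmod a0 ^ 2 + X - M ^ 2) ltac:(lra)) as [d [Hd Hcd]].
set (r := Rmax 0 (1 - d / 2)).
assert (Hr1 : 0 <= r < 1).
{ unfold r, Rmax. destruct (Rle_dec 0 (1 - d / 2)); lra. }
assert (Hrd : 1 - r <= d / 2) by (unfold r; generalize (Rmax_r 0 (1 - d / 2)); lra).
specialize (Hcd r). specialize (Hr r Hr1).
simpl in Hcd. unfold R_dist, D_x, no_cond in Hcd.
rewrite pow1 in Hcd.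
rewrite (Rabs_left (r - 1)) in Hcd by lra.
specialize (Hcd ltac:(split; [split; [exact I | lra] | lra])).
apply Rabs_lt_between in Hcd. simpl in Hr, Hlt, Hcd. lra.
Qed.

End Expansion.

(** * First-order expansion at the origin *)

(** The terms with k >= 1 carry a factor |z|^(2k), hence are O(|z|^2) although
    they may have nonzero linear coefficients themselves. *)
Lemma linear_part (q : nat) (F : C -> C) (a0 : C) (a b : nat -> nat -> C)
  (h g : nat -> C -> C) :
  (forall k, (k <= q)%nat -> forall z, Cmod z < 1 ->
    @is_series C_AbsRing C_NormedModule (fun n => (a n k * z ^ S n)%C) (h k z)) ->
  (forall k, (k <= q)%nat -> forall z, Cmod z < 1 ->
    @is_series C_AbsRing C_NormedModule (fun n => (b n k * z ^ S n)%C) (g k z)) ->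
  (forall z, Cmod z < 1 ->
    F z = (a0 + sum_n (fun k => RtoC (Cmod z ^ (2 * k)) * (h k z + Cconj (g k z))) q)%C) ->
  exists K, forall z, Cmod z <= / 4 ->
    Cmod (F z - (a0 + a 0%nat 0%nat * z + Cconj (b 0%nat 0%nat * z))) <= K * Cmod z ^ 2.
Proof.
intros Hh Hg HF.
assert (Hk : forall k, (k <= q)%nat -> exists K, 0 <= K /\ forall z, Cmod z <= / 4 ->
  Cmod (h k z + Cconj (g k z) - (a 0%nat k * z + Cconj (b 0%nat k * z)))
    <= K * Cmod z ^ 2).
{ intros k Hk.
  destruct (power_series_linear (fun n => a n k) (h k) (Hh k Hk)) as [K1 [HK1 H1]].
  destruct (power_series_linear (fun n => b n k) (g k) (Hg k Hk)) as [K2 [HK2 H2]].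
  exists (K1 + K2). split; [lra|]. intros z Hz.
  replace (h k z + Cconj (g k z) - (a 0%nat k * z + Cconj (b 0%nat k * z)))%C
    with ((h k z - a 0%nat k * z) + Cconj (g k z - b 0%nat k * z))%C
    by (rewrite Cminus_conj; ring).
  eapply Rle_trans; [apply Cmod_triangle|].
  rewrite Cmod_conj, Rmult_plus_distr_r.
  apply Rplus_le_compat; auto. }
cut (forall q', (q' <= q)%nat -> exists K, forall z, Cmod z <= / 4 ->
  Cmod (sum_n (fun k => RtoC (Cmod z ^ (2 * k)) * (h k z + Cconj (g k z)))%C q'
        - (a 0%nat 0%nat * z + Cconj (b 0%nat 0%nat * z))) <= K * Cmod z ^ 2).
{ intros H. destruct (H q (le_n q)) as [K HK]. exists K. intros z Hz.
  rewrite HF by lra.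
  eapply Rle_trans; [|apply (HK z Hz)]. right. f_equal. cring. }
induction q' as [|k IH]; intros Hq'.
- destruct (Hk 0%nat Hq') as [K [_ HK]]. exists K. intros z Hz.
  rewrite sum_O. simpl (Cmod z ^ (2 * 0)). rewrite Cmult_1_l. now apply HK.
- destruct (IH ltac:(lia)) as [K HK]. destruct (Hk (S k) Hq') as [K' [HK'0 HK']].
  exists (K + (K' + Cmod (a 0%nat (S k)) + Cmod (b 0%nat (S k)))). intros z Hz.
  rewrite Csum_Sn.
  match goal with |- Cmod (?x + ?y - ?w) <= _ =>
    replace (x + y - w)%C with ((x - w) + y)%C by cring end.
  eapply Rle_trans; [apply Cmod_triangle|].
  rewrite Rmult_plus_distr_r. apply Rplus_le_compat; [now apply HK|].
  assert (Hm := Cmod_ge_0 z).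
  rewrite Cmod_mult, Cmod_R, Rabs_pos_eq by now apply pow_le.
  rewrite Rmult_comm. apply Rmult_le_compat; [apply Cmod_ge_0 | now apply pow_le | |].
  + specialize (HK' z Hz).
    replace (h (S k) z + Cconj (g (S k) z))%C with
      ((h (S k) z + Cconj (g (S k) z) - (a 0%nat (S k) * z + Cconj (b 0%nat (S k) * z)))
       + (a 0%nat (S k) * z + Cconj (b 0%nat (S k) * z)))%C by cring.
    eapply Rle_trans; [apply Cmod_triangle|].
    eapply Rle_trans; [apply Rplus_le_compat; [exact HK' | apply Cmod_triangle]|].
    rewrite Cmod_conj, !Cmod_mult.
    assert (Ha := Cmod_ge_0 (a 0%nat (S k))). assert (Hb := Cmod_ge_0 (b 0%nat (S k))).
    assert (K' * Cmod z ^ 2 <= K' * 1) by (apply Rmult_le_compat_l; nra).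
    nra.
  + replace (2 * S k)%nat with (2 + 2 * k)%nat by lia. rewrite pow_add.
    rewrite <- (Rmult_1_r (Cmod z ^ 2)) at 2.
    apply Rmult_le_compat_l; [now apply pow_le|].
    rewrite <- (pow1 (2 * k)). apply pow_incr. lra.
Qed.

Lemma is_derive_quadratic (u : R -> R) (c l K : R) :
  (forall t, Rabs t <= / 4 -> Rabs (u t - (c + l * t)) <= K * t ^ 2) ->
  is_derive u 0 l.
Proof.
intros H. apply is_derive_Reals. intros eps Heps.
assert (Hd : 0 < Rmin (/ 4) (eps / (Rabs K + 1))).
{ apply Rmin_pos; [lra|]. apply Rdiv_lt_0_compat; [exact Heps|].
  generalize (Rabs_pos K); lra. }
assert (H0 : u 0 = c).
{ specialize (H 0 ltac:(rewrite Rabs_R0; lra)).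
  replace (K * 0 ^ 2) with 0 in H by ring.
  generalize (Rabs_pos (u 0 - (c + l * 0))). intros H1.
  destruct (Req_dec (u 0 - (c + l * 0)) 0) as [E|E]; [lra|].
  generalize (Rabs_pos_lt _ E). lra. }
exists (mkposreal _ Hd). intros t Ht Hlt. simpl in Hlt.
rewrite Rplus_0_l, H0.
assert (Ht1 := Rlt_le_trans _ _ _ Hlt (Rmin_l _ _)).
assert (Ht2 := Rlt_le_trans _ _ _ Hlt (Rmin_r _ _)).
assert (Hpos : 0 < Rabs t) by now apply Rabs_pos_lt.
replace ((u t - c) / t - l) with ((u t - (c + l * t)) / t) by (field; exact Ht).
unfold Rdiv. rewrite Rabs_mult, Rabs_inv.
apply Rlt_div_l; [exact Hpos|].
eapply Rle_lt_trans; [apply H; lra|].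
rewrite <- pow2_abs.
apply Rlt_div_r in Ht2; [|generalize (Rabs_pos K); lra].
generalize (Rle_abs K). intros. nra.
Qed.

(** The partial derivatives at 0 are those of the affine map, read off on the two
    coordinate axes. *)
Lemma wirtinger_at_0 (F : C -> C) (c al be : C) (K : R) :
  (forall z, Cmod z <= / 4 -> Cmod (F z - (c + al * z + Cconj (be * z))) <= K * Cmod z ^ 2) ->
  F (RtoC 0) = c /\ dz F (RtoC 0) = al /\ dzbar F (RtoC 0) = Cconj be.
Proof.
intros H.
assert (Him : forall w, Rabs (Im w) <= Cmod w).
{ intros w. rewrite <- (Cmod_conj w).
  replace (Im w) with (Re (Cconj w * Ci)%C) by (destruct w; simpl; ring).
  eapply Rle_trans; [apply re_le_Cmod|]. rewrite Cmod_mult, Cmod_Ci. lra. }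
assert (Hreal : forall t, Cmod (t, 0) = Rabs t) by (intros t; apply (Cmod_R t)).
assert (Himag : forall t, Cmod (0, t) = Rabs t).
{ intros t. replace ((0, t) : C) with (Ci * RtoC t)%C.
  - now rewrite Cmod_mult, Cmod_Ci, Rmult_1_l, Cmod_R.
  - unfold Ci, RtoC, Cmult; simpl; f_equal; ring. }
split.
{ specialize (H (RtoC 0)). rewrite Cmod_0 in H. specialize (H ltac:(lra)).
  replace (K * 0 ^ 2) with 0 in H by ring.
  replace (F (RtoC 0) - (c + al * RtoC 0 + Cconj (be * RtoC 0)))%C with (F (RtoC 0) - c)%C in H.
  - apply Ceq_minus, Cmod_eq_0. generalize (Cmod_ge_0 (F (RtoC 0) - c)). lra.
  - rewrite !Cmult_0_r. replace (Cconj (RtoC 0)) with (RtoC 0)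
      by (unfold Cconj, RtoC; simpl; now rewrite Ropp_0). ring. }
assert (D1 : is_derive (fun t => Re (F (t, 0))) 0 (Re al + Re be)).
{ apply (is_derive_quadratic _ (Re c) _ K). intros t Ht. rewrite <- (pow2_abs t), <- (Hreal t).
  eapply Rle_trans; [|apply H; rewrite Hreal; exact Ht].
  eapply Rle_trans; [|apply re_le_Cmod]. right. f_equal.
  destruct al, be, c; unfold Re, Im; simpl; ring. }
assert (D2 : is_derive (fun t => Im (F (t, 0))) 0 (Im al - Im be)).
{ apply (is_derive_quadratic _ (Im c) _ K). intros t Ht. rewrite <- (pow2_abs t), <- (Hreal t).
  eapply Rle_trans; [|apply H; rewrite Hreal; exact Ht].
  eapply Rle_trans; [|apply Him]. right. f_equal.
  destruct al, be, c; unfold Re, Im; simpl; ring. }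
assert (D3 : is_derive (fun t => Re (F (0, t))) 0 (- Im al - Im be)).
{ apply (is_derive_quadratic _ (Re c) _ K). intros t Ht. rewrite <- (pow2_abs t), <- (Himag t).
  eapply Rle_trans; [|apply H; rewrite Himag; exact Ht].
  eapply Rle_trans; [|apply re_le_Cmod]. right. f_equal.
  destruct al, be, c; unfold Re, Im; simpl; ring. }
assert (D4 : is_derive (fun t => Im (F (0, t))) 0 (Re al - Re be)).
{ apply (is_derive_quadratic _ (Im c) _ K). intros t Ht. rewrite <- (pow2_abs t), <- (Himag t).
  eapply Rle_trans; [|apply H; rewrite Himag; exact Ht].
  eapply Rle_trans; [|apply Him]. right. f_equal.
  destruct al, be, c; unfold Re, Im; simpl; ring. }
apply is_derive_unique in D1, D2, D3, D4.
assert (Ex : Cdx F (RtoC 0) = (al + Cconj be)%C).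
{ transitivity (Re al + Re be, Im al - Im be); [exact (f_equal2 pair D1 D2)|].
  destruct al, be; unfold Cplus, Cconj; simpl; f_equal; ring. }
assert (Ey : Cdy F (RtoC 0) = (Ci * (al - Cconj be))%C).
{ transitivity (- Im al - Im be, Re al - Re be); [exact (f_equal2 pair D3 D4)|].
  destruct al, be; unfold Cminus, Copp, Cplus, Cmult, Cconj, Ci; simpl; f_equal; ring. }
assert (Hi2 : forall w, (Ci * (Ci * w) = - w)%C).
{ intros [x y]. unfold Cmult, Ci, Copp; simpl; f_equal; ring. }
assert (H2 : RtoC 2 <> RtoC 0) by (intros E; apply RtoC_inj in E; lra).
unfold dz, dzbar. rewrite Ex, Ey, Hi2.
split; field; exact H2.
Qed.

(** * Sums over a strip of indices *)

Lemma sum_n_term_le (f : nat -> R) (m l : nat) :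
  (forall k, 0 <= f k) -> (l <= m)%nat -> f l <= sum_n f m.
Proof.
intros Hf. induction m as [|m IH]; intros Hl.
- rewrite sum_O. replace l with 0%nat by lia. apply Rle_refl.
- rewrite Rsum_Sn. destruct (Nat.eq_dec l (S m)) as [->|E].
  + generalize (sum_n_nonneg f m Hf). lra.
  + generalize (IH ltac:(lia)) (Hf (S m)). lra.
Qed.

Lemma double_sum_term_le (u : nat -> nat -> R) (N q i j : nat) :
  (forall n k, 0 <= u n k) -> (i <= N)%nat -> (j <= q)%nat ->
  u i j <= sum_n (fun n => sum_n (fun k => u n k) q) N.
Proof.
intros Hu Hi Hj.
eapply Rle_trans; [apply (sum_n_term_le (u i) q j (Hu i) Hj)|].
apply (sum_n_term_le (fun n => sum_n (fun k => u n k) q) N i); [|exact Hi].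
intros n. now apply sum_n_nonneg.
Qed.

Lemma double_sum_plus (u v : nat -> nat -> R) (N q : nat) :
  sum_n (fun n => sum_n (fun k => u n k + v n k) q) N
  = sum_n (fun n => sum_n (fun k => u n k) q) N
    + sum_n (fun n => sum_n (fun k => v n k) q) N.
Proof.
rewrite <- (sum_n_plus (G := R_AbelianMonoid)).
apply sum_n_ext. intros n. exact (sum_n_plus (G := R_AbelianMonoid) _ _ q).
Qed.

(** Split off the entry (0, 0): it is a term of one nonnegative array, and (i, j)
    is a term of the complementary one. *)
Lemma double_sum_two_terms_le (u : nat -> nat -> R) (N q i j : nat) :
  (forall n k, 0 <= u n k) -> (i <= N)%nat -> (j <= q)%nat -> (i, j) <> (0%nat, 0%nat) ->
  u 0%nat 0%nat + u i j <= sum_n (fun n => sum_n (fun k => u n k) q) N.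
Proof.
intros Hu Hi Hj Hne.
set (o := fun n k : nat => ((n =? 0) && (k =? 0))%nat%bool).
set (v := fun n k => if o n k then u n k else 0).
set (w := fun n k => if o n k then 0 else u n k).
assert (Hv : forall n k, 0 <= v n k)
  by (intros n k; unfold v; destruct (o n k); [apply Hu | lra]).
assert (Hw : forall n k, 0 <= w n k)
  by (intros n k; unfold w; destruct (o n k); [lra | apply Hu]).
replace (sum_n _ N) with (sum_n (fun n => sum_n (fun k => v n k + w n k) q) N).
- rewrite double_sum_plus. apply Rplus_le_compat.
  + exact (double_sum_term_le v N q 0 0 Hv ltac:(lia) ltac:(lia)).
  + replace (u i j) with (w i j); [now apply double_sum_term_le|].
    unfold w, o. destruct i, j; try reflexivity. now contradict Hne.
- apply sum_n_ext. intros n. apply sum_n_ext. intros k.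
  unfold v, w. destruct (o n k); [apply Rplus_0_r | apply Rplus_0_l].
Qed.

(** A bound on the finite double sums gives convergence in n for each k, and the
    finite sum over k commutes with the limit. *)
Lemma double_series_le (u : nat -> nat -> R) (q : nat) (B : R) :
  (forall n k, 0 <= u n k) ->
  (forall N, sum_n (fun n => sum_n (fun k => u n k) q) N <= B) ->
  (forall k, (k <= q)%nat -> ex_series (fun n => u n k)) /\
  sum_n (fun k => Series (fun n => u n k)) q <= B.
Proof.
intros Hu HB.
assert (Hsw : forall N, sum_n (fun k => sum_n (fun n => u n k) N) q <= B).
{ intros N. rewrite sum_n_switch. apply HB. }
assert (Hex : forall k, (k <= q)%nat -> ex_series (fun n => u n k)).
{ intros k Hk.
  apply (ex_finite_lim_seq_incr (sum_n (fun n => u n k)) B).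
  - intros n. rewrite Rsum_Sn. generalize (Hu (S n) k). lra.
  - intros N. eapply Rle_trans; [|apply (HB N)].
    apply sum_n_le_loc. intros n _.
    exact (sum_n_term_le (u n) q k (Hu n) Hk). }
split; [exact Hex|].
assert (Hlim : forall q', (q' <= q)%nat ->
  is_lim_seq (fun N => sum_n (fun k => sum_n (fun n => u n k) N) q')
    (sum_n (fun k => Series (fun n => u n k)) q')).
{ induction q' as [|q' IH]; intros Hq'.
  - rewrite sum_O. apply (is_lim_seq_ext (sum_n (fun n => u n 0%nat))).
    + intros N. now rewrite sum_O.
    + apply Series_correct, Hex. lia.
  - rewrite Rsum_Sn.
    apply (is_lim_seq_ext (fun N => sum_n (fun k => sum_n (fun n => u n k) N) q'
        + sum_n (fun n => u n (S q')) N)).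
    + intros N. now rewrite Rsum_Sn.
    + apply is_lim_seq_plus'; [apply IH; lia|].
      apply Series_correct, Hex. exact Hq'. }
exact (is_lim_seq_le _ (fun _ => B) _ _ Hsw (Hlim q (le_n q)) (is_lim_seq_const B)).
Qed.

(** * Elementary inequalities for the normalized case *)

Lemma le_sqrt_of_sq_le (x y : R) : x ^ 2 <= y -> x <= sqrt y.
Proof.
intros H.
destruct (Rle_lt_dec x 0) as [Hx|Hx].
- generalize (sqrt_pos y). lra.
- rewrite <- (sqrt_pow2 x) by lra. now apply sqrt_le_1_alt.
Qed.

(** With s = X + Y and l = |X - Y| the hypotheses read s l = 1 and
    s^2 + l^2 <= 2 M^2, and X^2 + Y^2 = (s^2 + l^2) / 2.  The first bound is
    0 <= (M^2 l - s)^2, the second 2 <= s^2 + l^2.  The third expresses that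
    s^2 is at most the larger root M^2 + sqrt (M^4 - 1) of
    x^2 - 2 M^2 x + 1 = 0. *)
Lemma product_bounds (X Y M : R) : 0 <= X -> 0 <= Y -> 0 < M ->
  X ^ 2 + Y ^ 2 <= M ^ 2 -> Rabs (X ^ 2 - Y ^ 2) = 1 ->
  sqrt (2 * M ^ 2 - 2 * (X ^ 2 + Y ^ 2)) <= sqrt (M ^ 4 - 1) * Rabs (X - Y) /\
  sqrt (2 * M ^ 2 - 2 * (X ^ 2 + Y ^ 2)) <= sqrt (2 * M ^ 2 - 2) /\
  lambda0 M <= Rabs (X - Y).
Proof.
intros HX HY HM Hle H1.
assert (Hls : Rabs (X - Y) * (X + Y) = 1).
{ rewrite <- H1. rewrite <- (Rabs_pos_eq (X + Y)) at 1 by lra.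
  rewrite <- Rabs_mult. f_equal. ring. }
assert (Hl0 := Rabs_pos (X - Y)).
assert (Hl2 : Rabs (X - Y) ^ 2 = (X - Y) ^ 2) by apply pow2_abs.
set (l := Rabs (X - Y)) in *. set (s := X + Y) in *.
assert (E : 2 * (X ^ 2 + Y ^ 2) = s ^ 2 + l ^ 2) by (rewrite Hl2; unfold s; ring).
assert (Hs : 0 < s) by (unfold s in *; nra).
assert (Hlpos : 0 < l) by nra.
assert (Hls2 : l ^ 2 * s ^ 2 = 1) by (replace (l ^ 2 * s ^ 2) with ((l * s) ^ 2) by ring; rewrite Hls; ring).
assert (Hsl : s ^ 2 + l ^ 2 <= 2 * M ^ 2) by lra.
assert (Hagm : 2 <= s ^ 2 + l ^ 2)
  by (assert (0 <= (l - s) ^ 2) by apply pow2_ge_0; nra).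
assert (HM1 : 1 <= M ^ 2) by lra.
rewrite !E. repeat split.
- rewrite <- (sqrt_pow2 l) by exact Hl0.
  rewrite <- sqrt_mult_alt by (replace (M ^ 4) with (M ^ 2 * M ^ 2) by ring; nra).
  apply sqrt_le_1_alt. rewrite sqrt_pow2 by exact Hl0.
  assert (0 <= (M ^ 2 * l - s) ^ 2) by apply pow2_ge_0.
  assert (M ^ 2 * (l * s) = M ^ 2) by (rewrite Hls; ring). nra.
- apply sqrt_le_1_alt. lra.
- unfold lambda0.
  set (A := sqrt (M ^ 2 - 1)). set (B := sqrt (M ^ 2 + 1)).
  assert (HA : 0 <= A) by apply sqrt_pos.
  assert (HB : 0 < B) by (apply sqrt_lt_R0; lra).
  assert (HA2 : A ^ 2 = M ^ 2 - 1) by (apply pow2_sqrt; lra).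
  assert (HB2 : B ^ 2 = M ^ 2 + 1) by (apply pow2_sqrt; lra).
  apply Rle_div_l; [lra|].
  assert (HAB : s ^ 2 - M ^ 2 <= A * B).
  { unfold A, B. rewrite <- sqrt_mult by lra. apply le_sqrt_of_sq_le.
    assert (0 <= s ^ 2) by apply pow2_ge_0. nra. }
  assert (Hsq : 2 <= (l * (A + B)) ^ 2).
  { replace ((l * (A + B)) ^ 2) with (l ^ 2 * (A ^ 2 + B ^ 2 + 2 * (A * B))) by ring.
    rewrite HA2, HB2. assert (0 <= l ^ 2) by apply pow2_ge_0. nra. }
  rewrite <- (sqrt_pow2 (l * (A + B))) by (apply Rmult_le_pos; lra).
  now apply sqrt_le_1_alt.
Qed.

(** * The coefficient bounds *)

(** With v = (|a| + |b|)^2, w = (|a| - |b|)^2 and u = |a|^2 + |b|^2 one has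
    v + w = 2 u.  Summing and keeping only the (0, 0) entry of w gives the bound
    on the sum of v without its (0, 0) entry. *)
Lemma coefficient_sums_le (a b : nat -> nat -> C) (q : nat) (M : R) :
  (forall N, sum_n (fun n => sum_n (fun k =>
     Cmod (a n k) ^ 2 + Cmod (b n k) ^ 2) q) N <= M ^ 2) ->
  let D := 2 * M ^ 2 - 2 * (Cmod (a 0%nat 0%nat) ^ 2 + Cmod (b 0%nat 0%nat) ^ 2) in
  (forall k, (k <= q)%nat -> ex_series (fun n => (Cmod (a n k) + Cmod (b n k)) ^ 2)) /\
  sum_n (fun k => Series (fun n => (Cmod (a n k) + Cmod (b n k)) ^ 2)) q
    - (Cmod (a 0%nat 0%nat) + Cmod (b 0%nat 0%nat)) ^ 2 <= D /\
  (forall n k, (k <= q)%nat -> (n, k) <> (0%nat, 0%nat) ->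
     Cmod (a n k) + Cmod (b n k) <= sqrt D).
Proof.
intros H D.
set (u := fun n k => Cmod (a n k) ^ 2 + Cmod (b n k) ^ 2).
set (v := fun n k => (Cmod (a n k) + Cmod (b n k)) ^ 2).
set (w := fun n k => (Cmod (a n k) - Cmod (b n k)) ^ 2).
assert (Hu : forall n k, 0 <= u n k)
  by (intros n k; unfold u; generalize (pow2_ge_0 (Cmod (a n k)))
        (pow2_ge_0 (Cmod (b n k))); lra).
change (forall N, sum_n (fun n => sum_n (fun k => u n k) q) N <= M ^ 2) in H.
assert (Hv : forall N, sum_n (fun n => sum_n (fun k => v n k) q) N
   <= D + (Cmod (a 0%nat 0%nat) + Cmod (b 0%nat 0%nat)) ^ 2).
{ intros N.
  assert (E : sum_n (fun n => sum_n (fun k => v n k) q) N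
     + sum_n (fun n => sum_n (fun k => w n k) q) N
     = sum_n (fun n => sum_n (fun k => u n k) q) N
     + sum_n (fun n => sum_n (fun k => u n k) q) N).
  { rewrite <- !double_sum_plus.
    apply sum_n_ext. intros n. apply sum_n_ext. intros k. unfold u, v, w. simpl. ring. }
  assert (Hw := double_sum_term_le w N q 0 0 (fun n k => pow2_ge_0 _) ltac:(lia) ltac:(lia)).
  specialize (H N). unfold w in Hw at 1. unfold D. nra. }
destruct (double_series_le v q _ (fun n k => pow2_ge_0 _) Hv) as [Hex Hle].
split; [exact Hex|]. split; [unfold v in Hle; lra|].
intros n k Hk Hne. apply le_sqrt_of_sq_le.
assert (Ht := double_sum_two_terms_le u n q n k Hu ltac:(lia) Hk Hne).
specialize (H n).
assert (Hp := pow2_ge_0 (Cmod (a n k) - Cmod (b n k))).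
apply (fun x => Rle_trans _ _ _ x H) in Ht. unfold u in Ht. unfold D. nra.
Qed.

Theorem theorem1 (p : nat) (F : C -> C) (a0 : C) (a b : nat -> nat -> C)
  (h g : nat -> C -> C) (M : R)
  (hp : (1 <= p)%nat)
  (hF : polyharmonic p unit_disk F)
  (hh : forall k : nat, (1 <= k <= p)%nat ->
     holomorphic unit_disk (h k) /\
     forall z : C, unit_disk z ->
       @is_series C_AbsRing C_NormedModule
         (fun n : nat => (a (S n) k * z ^ (S n))%C) (h k z))
  (hg : forall k : nat, (1 <= k <= p)%nat ->
     holomorphic unit_disk (g k) /\
     forall z : C, unit_disk z ->
       @is_series C_AbsRing C_NormedModule
         (fun n : nat => (b (S n) k * z ^ (S n))%C) (g k z))
  (hform : forall z : C, unit_disk z ->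
     F z = (a0 + @sum_n_m C_AbelianMonoid
       (fun k : nat =>
          RtoC (Cmod z ^ (2 * (k - 1))) * (h k z + Cconj (g k z))) 1 p)%C)
  (harga : forall n k1 k2 : nat, (1 <= n)%nat ->
     (1 <= k1 <= p)%nat -> (1 <= k2 <= p)%nat ->
     a n k1 <> RtoC 0 -> a n k2 <> RtoC 0 ->
     Rabs (Carg (a n k1 / a n k2)%C) <= PI / 2)
  (hargb : forall n k3 k4 : nat, (1 <= n)%nat ->
     (1 <= k3 <= p)%nat -> (1 <= k4 <= p)%nat ->
     b n k3 <> RtoC 0 -> b n k4 <> RtoC 0 ->
     Rabs (Carg (b n k3 / b n k4)%C) <= PI / 2)
  (hM : 0 < M) :
  (* (I) *)
  ((forall z : C, unit_disk z -> Cmod (F z) <= M) ->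
     (forall k : nat, (1 <= k <= p)%nat ->
        ex_series (fun n : nat => Cmod (a (S n) k) ^ 2 + Cmod (b (S n) k) ^ 2)) /\
     Cmod a0 ^ 2 +
       sum_n_m (fun k : nat =>
         Series (fun n : nat => Cmod (a (S n) k) ^ 2 + Cmod (b (S n) k) ^ 2)) 1 p
       <= M ^ 2 /\
     (forall n k : nat, (1 <= n)%nat -> (1 <= k <= p)%nat ->
        Cmod (a n k) + Cmod (b n k) <= sqrt 2 * M))
  /\
  (* (II) *)
  ((forall z : C, unit_disk z -> Cmod (F z) <= M) ->
   F (RtoC 0) = RtoC 0 -> Rabs (Jacobian F (RtoC 0)) - 1 = 0 ->
     (forall k : nat, (1 <= k <= p)%nat ->
        ex_series (fun n : nat => (Cmod (a (S n) k) + Cmod (b (S n) k)) ^ 2)) /\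
     sqrt (sum_n_m (fun k : nat =>
             Series (fun n : nat => (Cmod (a (S n) k) + Cmod (b (S n) k)) ^ 2)) 1 p
           - (Cmod (a 1%nat 1%nat) + Cmod (b 1%nat 1%nat)) ^ 2)
       <= sqrt (M ^ 4 - 1) * lambda F (RtoC 0) /\
     (forall n k : nat, (1 <= n)%nat -> (1 <= k <= p)%nat ->
        (n, k) <> (1%nat, 1%nat) ->
        Cmod (a n k) + Cmod (b n k) <= T1 M F) /\
     lambda F (RtoC 0) >= lambda0 M)
  /\
  (* (III) *)
  ((forall z : C, unit_disk z -> Cmod (F z) <= M) ->
   F (RtoC 0) = RtoC 0 -> lambda F (RtoC 0) - 1 = 0 ->
     (forall k : nat, (1 <= k <= p)%nat ->
        ex_series (fun n : nat => (Cmod (a (S n) k) + Cmod (b (S n) k)) ^ 2)) /\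
     sqrt (sum_n_m (fun k : nat =>
             Series (fun n : nat => (Cmod (a (S n) k) + Cmod (b (S n) k)) ^ 2)) 1 p
           - (Cmod (a 1%nat 1%nat) + Cmod (b 1%nat 1%nat)) ^ 2)
       <= sqrt (2 * M ^ 2 - 2) /\
     (forall n k : nat, (1 <= n)%nat -> (1 <= k <= p)%nat ->
        (n, k) <> (1%nat, 1%nat) ->
        Cmod (a n k) + Cmod (b n k) <= sqrt (2 * M ^ 2 - 2))).
Proof.
(* Both indices are shifted to start at 0. *)
destruct p as [|q]; [lia|].
set (a' := fun n k => a (S n) (S k)). set (b' := fun n k => b (S n) (S k)).
set (h' := fun k => h (S k)). set (g' := fun k => g (S k)).
assert (Hh : forall k, (k <= q)%nat -> forall z, Cmod z < 1 ->
  @is_series C_AbsRing C_NormedModule (fun n => (a' n k * z ^ S n)%C) (h' k z))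
  by (intros k Hk; apply hh; lia).
assert (Hg : forall k, (k <= q)%nat -> forall z, Cmod z < 1 ->
  @is_series C_AbsRing C_NormedModule (fun n => (b' n k * z ^ S n)%C) (g' k z))
  by (intros k Hk; apply hg; lia).
assert (HF : forall z, Cmod z < 1 ->
  F z = (a0 + sum_n (fun k => RtoC (Cmod z ^ (2 * k)) * (h' k z + Cconj (g' k z))) q)%C).
{ intros z Hz. rewrite (hform z Hz), <- sum_n_m_S. f_equal.
  apply sum_n_ext. intros k. now rewrite Nat.sub_succ, Nat.sub_0_r. }
assert (Ha : forall n i j, (i <= q)%nat -> (j <= q)%nat ->
  0 <= Re (a' n i * Cconj (a' n j))%C)
  by (intros; apply Re_mul_conj_nonneg; intros; apply harga; assumption || lia).
assert (Hb : forall n i j, (i <= q)%nat -> (j <= q)%nat ->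
  0 <= Re (b' n i * Cconj (b' n j))%C)
  by (intros; apply Re_mul_conj_nonneg; intros; apply hargb; assumption || lia).
assert (Hsum := fun HB N =>
  coefficients_sq_le q F a0 a' b' h' g' Hh Hg HF Ha Hb M N HB).
destruct (linear_part q F a0 a' b' h' g' Hh Hg HF) as [K HK].
destruct (wirtinger_at_0 F a0 _ _ K HK) as [HF0 [Hdz Hdzb]].
assert (Hlam : lambda F (RtoC 0) = Rabs (Cmod (a 1%nat 1%nat) - Cmod (b 1%nat 1%nat)))
  by (unfold lambda; rewrite Hdz, Hdzb, Cmod_conj; reflexivity).
assert (HJ : Jacobian F (RtoC 0) = Cmod (a 1%nat 1%nat) ^ 2 - Cmod (b 1%nat 1%nat) ^ 2)
  by (unfold Jacobian; rewrite Hdz, Hdzb, Cmod_conj; reflexivity).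
assert (Hindex : forall P : nat -> nat -> Prop,
  (forall n k, (k <= q)%nat -> (n, k) <> (0%nat, 0%nat) -> P (S n) (S k)) ->
  forall n k, (1 <= n)%nat -> (1 <= k <= S q)%nat -> (n, k) <> (1%nat, 1%nat) -> P n k).
{ intros P HP [|n] [|k] H1 H2 H3; try lia. apply HP; [lia|]. congruence. }
assert (Hreindex : forall f : nat -> R, sum_n_m f 1 (S q) = sum_n (fun k => f (S k)) q)
  by (intros f; symmetry; apply (sum_n_m_S (G := R_AbelianMonoid))).
assert (Hnorm : (forall z, unit_disk z -> Cmod (F z) <= M) -> F (RtoC 0) = RtoC 0 ->
  let D := 2 * M ^ 2 - 2 * (Cmod (a 1%nat 1%nat) ^ 2 + Cmod (b 1%nat 1%nat) ^ 2) in
  (forall k, (1 <= k <= S q)%nat ->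
     ex_series (fun n => (Cmod (a (S n) k) + Cmod (b (S n) k)) ^ 2)) /\
  sqrt (sum_n_m (fun k => Series (fun n => (Cmod (a (S n) k) + Cmod (b (S n) k)) ^ 2)) 1 (S q)
        - (Cmod (a 1%nat 1%nat) + Cmod (b 1%nat 1%nat)) ^ 2) <= sqrt D /\
  (forall n k, (1 <= n)%nat -> (1 <= k <= S q)%nat -> (n, k) <> (1%nat, 1%nat) ->
     Cmod (a n k) + Cmod (b n k) <= sqrt D) /\
  Cmod (a 1%nat 1%nat) ^ 2 + Cmod (b 1%nat 1%nat) ^ 2 <= M ^ 2).
{ intros HB H0 D. rewrite H0 in HF0. rewrite <- HF0, Cmod_0 in Hsum.
  assert (Hsum' : forall N, sum_n (fun n => sum_n (fun k =>
     Cmod (a' n k) ^ 2 + Cmod (b' n k) ^ 2) q) N <= M ^ 2)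
    by (intros N; generalize (Hsum HB N); lra).
  destruct (coefficient_sums_le a' b' q M Hsum') as [Hex [Hser Hco]].
  repeat split.
  - intros [|k] Hk; [lia|]. apply Hex. lia.
  - rewrite Hreindex. apply sqrt_le_1_alt. exact Hser.
  - apply Hindex. exact Hco.
  - eapply Rle_trans; [|apply (Hsum' 0%nat)].
    apply (double_sum_term_le (fun n k => Cmod (a' n k) ^ 2 + Cmod (b' n k) ^ 2) 0 q 0 0);
      try lia.
    intros n k. generalize (pow2_ge_0 (Cmod (a' n k))) (pow2_ge_0 (Cmod (b' n k))). lra. }
split; [|split].
- intros HB.
  set (u := fun n k => Cmod (a' n k) ^ 2 + Cmod (b' n k) ^ 2) in *.
  assert (Hu : forall n k, 0 <= u n k)
    by (intros n k; unfold u; generalize (pow2_ge_0 (Cmod (a' n k)))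
          (pow2_ge_0 (Cmod (b' n k))); lra).
  destruct (double_series_le u q (M ^ 2 - Cmod a0 ^ 2) Hu) as [Hex Hle].
  { intros N. generalize (Hsum HB N). unfold u. lra. }
  repeat split.
  + intros [|k] Hk; [lia|]. apply Hex. lia.
  + rewrite Hreindex. unfold u, a', b' in Hle. lra.
  + intros [|n] [|k] Hn Hk; try lia.
    assert (Ht := double_sum_term_le u n q n k Hu ltac:(lia) ltac:(lia)).
    assert (HN := Rle_trans _ _ _ (Rplus_le_compat_l (Cmod a0 ^ 2) _ _ Ht) (Hsum HB n)).
    unfold u, a', b' in HN.
    assert (Hp := pow2_ge_0 (Cmod (a (S n) (S k)) - Cmod (b (S n) (S k)))).
    assert (Hp0 := pow2_ge_0 (Cmod a0)).
    rewrite <- (sqrt_pow2 M) by lra. rewrite <- sqrt_mult by nra.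
    apply le_sqrt_of_sq_le. nra.
- intros HB H0 HJ1. destruct (Hnorm HB H0) as [Hex [Hser [Hco Hle]]].
  rewrite HJ in HJ1.
  destruct (product_bounds _ _ M (Cmod_ge_0 (a 1%nat 1%nat)) (Cmod_ge_0 (b 1%nat 1%nat))
    hM Hle ltac:(lra)) as [B1 [B2 B3]].
  rewrite <- Hlam in B1, B3.
  repeat split.
  + exact Hex.
  + eapply Rle_trans; [exact Hser | exact B1].
  + intros n k Hn Hk Hne. unfold T1. specialize (Hco n k Hn Hk Hne).
    apply Rmin_glb; eapply Rle_trans; eassumption.
  + apply Rle_ge. exact B3.
- intros HB H0 Hl1. destruct (Hnorm HB H0) as [Hex [Hser [Hco Hle]]].
  assert (HD : 2 * M ^ 2 - 2 * (Cmod (a 1%nat 1%nat) ^ 2 + Cmod (b 1%nat 1%nat) ^ 2)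
    <= 2 * M ^ 2 - 2).
  { assert (Hl : Rabs (Cmod (a 1%nat 1%nat) - Cmod (b 1%nat 1%nat)) ^ 2 = 1)
      by (rewrite <- Hlam; replace (lambda F (RtoC 0)) with 1 by lra; ring).
    rewrite pow2_abs in Hl.
    assert (HX := Cmod_ge_0 (a 1%nat 1%nat)). assert (HY := Cmod_ge_0 (b 1%nat 1%nat)).
    nra. }
  apply sqrt_le_1_alt in HD.
  repeat split.
  + exact Hex.
  + eapply Rle_trans; [exact Hser | exact HD].
  + intros n k Hn Hk Hne. eapply Rle_trans; [now apply Hco | exact HD].
Qed.
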